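(* Let $N\ge3$, $\varphi\in\mathbb R$, and put $\ell_N:=\lfloor N/2\rfloor$ and $\varepsilon_N:=N\bmod 2\in\{0,1\}$. There is a monic real-rooted polynomial $R_{N,\varphi}\in\mathbb R[t]$ of degree $\ell_N$ such that $$Q_{N,\varphi}(z)=e^{i\ell_N\varphi}z^{\varepsilon_N}R_{N,\varphi}\bigl(e^{-i\varphi}z^2\bigr).$$ Consequently, $Q_{N,\varphi}(z)=0$ implies $z\in\mathcal X_{\varphi/2}$. More generally, if $\vartheta\in\mathbb R$ and $\tau=e^{i\kappa}$ ($\kappa\in\mathbb R$) satisfy $$\cos(N\vartheta)+e^{iN\varphi}\cos\kappa=0,$$ then $\chi^{\tau}_{N,\varphi,\vartheta}=Q_{N,\varphi}$ and $\operatorname{spec}A_N^\tau(\varphi,\vartheta)\subset\mathcal X_{\varphi/2}$. Such a pair $(\vartheta,\tau)$ exists for every $N$ and $\varphi$; one may always take $\vartheta=\frac{\pi}{2N}$, $\tau=i$. Finally, every zero $z$ of $Q_{N,\varphi}$ satisfies $$z\in e^{i\varphi/2}\mathbb R\ \Longrightarrow\ |z|\le2\bigl|\cos\tfrac{\varphi}{2}\bigr|,\qquad z\in e^{i(\varphi/2+\pi/2)}\mathbb R\ \Longrightarrow\ |z|\le2\bigl|\sin\tfrac{\varphi}{2}\bigr|.$$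
   Context: Indices of $\mathbb C^N$ are in $\mathbb Z/N\mathbb Z$, represented by $0,\dots,N-1$, with standard basis $(e_j)$. For $|\tau|=1$ let $S_\tau e_j=e_{j+1}$ for $0\le j<N-1$, $S_\tau e_{N-1}=\tau e_0$. Set $D_N(\vartheta)=\operatorname{diag}\bigl(\cos(\tfrac{2\pi j}{N}+\vartheta)\bigr)_{j\in\mathbb Z/N\mathbb Z}$, $A_N^\tau(\varphi,\vartheta)=e^{i\varphi}\frac{S_\tau+S_\tau^{-1}}2+D_N(\vartheta)$ (the superscript $\tau$ is the boundary twist, not a power), and $\chi^{\tau}_{N,\varphi,\vartheta}(z)=\det\bigl(zI-A_N^\tau(\varphi,\vartheta)\bigr)$. $Q_{N,\varphi}(z)$ denotes the monic polynomial, independent of $\vartheta$ and $\tau$, characterized by $$\chi^{e^{i\kappa}}_{N,\varphi,\vartheta}(z)=Q_{N,\varphi}(z)-2^{1-N}\cos(N\vartheta)-2^{1-N}e^{iN\varphi}\cos\kappa\qquad\text{for all }\vartheta,\kappa\in\mathbb R;$$ explicitly, $Q_{N,\varphi}(z)=\chi^{1}_{N,\varphi,0}(z)+2^{1-N}+2^{1-N}e^{iN\varphi}$. For $\alpha\in\mathbb R$, $\mathcal X_\alpha:=e^{i\alpha}\mathbb R\cup e^{i(\alpha+\pi/2)}\mathbb R$. *)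

(* Defs.v *)
From HB Require Import structures.
From mathcomp Require Import all_boot all_order all_algebra.
From mathcomp Require Import complex.
From mathcomp Require Import boolp classical_sets reals trigo.

Set Implicit Arguments.
Unset Strict Implicit.
Unset Printing Implicit Defensive.

Import Order.TTheory GRing.Theory Num.Theory.
Local Open Scope classical_set_scope.
Local Open Scope complex_scope.
Local Open Scope ring_scope.

Section Defs.
Variable R : realType.

Definition expi (x : R) : R[i] := cos x +i* sin x.

(* Entry (k, j) is the coefficient of e_k in S_tau e_j. *)
Definition twisted_shift (N : nat) (tau : R[i]) : 'M[R[i]]_N :=
  \matrix_(k, j)
    if j.+1 == N then (if k == 0 :> nat then tau else 0)
    else (k == j.+1 :> nat)%:R.

Definition potential (N : nat) (theta : R) : 'M[R[i]]_N :=
  diag_mx (\row_j (cos (2 * pi * j%:R / N%:R + theta))%:C).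

(* invmx is the genuine inverse whenever tau != 0. *)
Definition opA (N : nat) (tau : R[i]) (phi theta : R) : 'M[R[i]]_N :=
  (expi phi / 2) *: (twisted_shift N tau + invmx (twisted_shift N tau))
  + potential N theta.

Definition chi (N : nat) (tau : R[i]) (phi theta : R) : {poly R[i]} :=
  char_poly (opA N tau phi theta).

(* The explicit form of the monic polynomial Q with
     chi N (expi kappa) phi theta
       = Q - 2^{1-N} cos(N theta) - 2^{1-N} e^{iN phi} cos kappa
   for all theta and kappa (take theta = kappa = 0).  For N >= 1, 2 ^- N.-1
   is 2^{1-N}. *)
Definition Qpoly (N : nat) (phi : R) : {poly R[i]} :=
  chi N 1 phi 0 + (2 ^- N.-1)%:P + (2 ^- N.-1 * expi (N%:R * phi))%:P.

Definition line (alpha : R) : set R[i] :=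
  [set z | exists t : R, z = expi alpha * t%:C].

Definition cross (alpha : R) : set R[i] :=
  line alpha `|` line (alpha + pi / 2).

Definition spec (N : nat) (A : 'M[R[i]]_N) : set R[i] :=
  [set z | eigenvalue A z].

Definition real_rooted (P : {poly R}) : Prop :=
  forall z : R[i], root (map_poly (real_complex R) P) z ->
  exists x : R, z = x%:C.

(* The pair (theta, tau) satisfies cos(N theta) + e^{iN phi} cos kappa = 0
   for some real kappa with tau = e^{i kappa}. *)
Definition balanced (N : nat) (phi theta : R) (tau : R[i]) : Prop :=
  exists kappa : R, tau = expi kappa /\
    (cos (N%:R * theta))%:C + expi (N%:R * phi) * (cos kappa)%:C = 0.

End Defs.

(* Main.v *)
(** With [S = S_tau] and [V = diag (e^{i (2 pi j / N + theta)})], the matrix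
    [A] is [(e^{i phi} (S + S^-1) + V + V^-1) / 2] with [V S = omega S V].  In
    an eigenbasis of [W = S^-1 V] it has zero diagonal: it only hops between
    neighbours on a ring, with hopping products [e^{i phi} d_k].  Comparing how
    the two cyclic determinants depend on the twist gives the Chambers formula.
    Choosing the phase of [W] so that one bond of the ring is cut then shows
    that [Q] is the continuant of the path with hopping products [e^{i phi} d_k]
    where [d_k = sin (phi + pi (k+1) / N) sin (pi (k+1) / N)], which is
    [e^{i l phi} z^eps R (e^{- i phi} z^2)].

    The sequence [d_k] changes sign at most once.  Cutting the path at the site
    of the sign change, the ratios of consecutive continuants coming from the
    two ends have imaginary parts of opposite sign, so that [R] has no nonreal
    root.  The bounds on the zeros come from the numerical range of [A] for a
    balanced pair [(theta, tau)]. *)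

Require Import Defs.
From HB Require Import structures.
From mathcomp Require Import all_boot all_order all_algebra.
From mathcomp Require Import complex.
From mathcomp Require Import boolp classical_sets reals trigo.
From mathcomp Require Import ring lra.

Set Implicit Arguments.
Unset Strict Implicit.
Unset Printing Implicit Defensive.

Import Order.TTheory GRing.Theory Num.Theory.
Local Open Scope classical_set_scope.
Local Open Scope complex_scope.
Local Open Scope ring_scope.

(** * Determinants of tridiagonal and cyclic band matrices, and continuants *)

Section Determinants.
Variable K : comNzRingType.
Implicit Types (a b c e : nat -> K) (x y : K).

(** Off-diagonal entries are indexed by bonds: [b k] and [c k] are the two entries of the bond
    between sites [k] and [k.+1], so hopping products are [b k * c k]. *)
Definition band a b c (i j : nat) : K :=
  a i *+ (i == j) + b i *+ (j == i.+1) + c j *+ (i == j.+1).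

Definition tridiag n a b c : 'M[K]_n := \matrix_(i, j) band a b c i j.

Definition cyclic n a b c : 'M[K]_n :=
  \matrix_(i, j) (a i *+ (i == j) + b i *+ (j == ordS i)
                  + c j *+ (i == ordS j)).

(** Determinant of a path of [n] sites with [x] on the diagonal and hopping product [e k] on bond
    [k]; see [det_tridiag]. *)
Fixpoint continuant x e (n : nat) : K :=
  if n is n'.+1 then
    x * continuant x e n' - (if n' is n''.+1 then e n'' * continuant x e n'' else 0)
  else 1.

Lemma continuantSS x e n :
  continuant x e n.+2 = x * continuant x e n.+1 - e n * continuant x e n.
Proof. by []. Qed.

Lemma eq_continuant x e e' n :
  (forall k, (k.+1 < n)%N -> e k = e' k) -> continuant x e n = continuant x e' n.
Proof.
elim/ltn_ind: n => -[|[|n]] IH Ee //.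
rewrite !continuantSS !IH ?Ee // => k lt_k; apply: Ee.
  exact/leqW/leqW.
exact: leqW.
Qed.

Lemma continuant_cat x e k l :
  continuant x e (k.+1 + l.+1) =
    continuant x e k.+1 * continuant x (fun j => e (k.+1 + j)%N) l.+1
    - e k * continuant x e k * continuant x (fun j => e (k.+2 + j)%N) l.
Proof.
elim/ltn_ind: l => -[|[|l]] IH.
- by rewrite addn1 continuantSS /= mulr1 subr0 !mulr1 mulrC.
- rewrite addnS continuantSS addn1 continuantSS /= !addn0 !(mulr1, subr0); ring.
have E m : continuant x e (k.+1 + m.+2) =
    x * continuant x e (k.+1 + m.+1) - e (k.+1 + m)%N * continuant x e (k.+1 + m).
  by rewrite !addnS.
rewrite E (IH l.+1)// (IH l)//.
rewrite [continuant _ (fun j => e (k.+1 + j)%N) l.+3]continuantSS.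
rewrite [continuant _ (fun j => e (k.+2 + j)%N) l.+2]continuantSS.
rewrite [(k.+2 + l)%N]addSnnS; ring.
Qed.

Lemma continuant_recl x e l :
  continuant x e l.+2 =
    x * continuant x (fun j => e j.+1) l.+1
    - e 0%N * continuant x (fun j => e j.+2) l.
Proof. by rewrite -[l.+2]/(1 + l.+1)%N continuant_cat /= subr0 !mulr1. Qed.

Lemma bump_small h i : (i < h)%N -> bump h i = i.
Proof. by move=> lt_ih; rewrite /bump leqNgt lt_ih. Qed.

Lemma band_diag a b c i : band a b c i i = a i.
Proof. by rewrite /band eqxx ltn_eqF// !addr0. Qed.

Lemma band_upper a b c i : band a b c i i.+1 = b i.
Proof. by rewrite /band eqxx !ltn_eqF// addr0 add0r. Qed.

Lemma band_lower a b c i : band a b c i.+1 i = c i.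
Proof. by rewrite /band eqxx gtn_eqF// ltn_eqF// !add0r. Qed.

Lemma band_far a b c i j : (i.+1 < j)%N || (j.+1 < i)%N -> band a b c i j = 0.
Proof.
rewrite /band => /orP[] lt_ij; rewrite (gtn_eqF lt_ij).
  by rewrite (ltn_eqF (ltnW lt_ij)) (ltn_eqF (leqW (ltnW lt_ij))) !addr0.
by rewrite (gtn_eqF (ltnW lt_ij)) (ltn_eqF (leqW (ltnW lt_ij))) !addr0.
Qed.

Lemma det_tridiag n x b c :
  \det (tridiag n (fun=> x) b c) = continuant x (fun k => b k * c k) n.
Proof.
elim/ltn_ind: n => -[|[|n]] IH.
- by rewrite det_mx00.
- by rewrite det_mx11 mxE band_diag /= subr0 mulr1.
rewrite continuantSS (expand_det_row _ ord_max) big_ord_recr big_ord_recr /=.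
rewrite big1 ?add0r => [|i _]; last first.
  by rewrite mxE band_far ?mul0r//= !ltnS ltn_ord orbT.
rewrite addrC !mxE /= band_diag band_lower; congr (_ + _).
  congr (_ * _); rewrite /cofactor -signr_odd addnn odd_double mul1r.
  rewrite -[RHS]/(continuant x (fun k => b k * c k) n.+1) -IH//.
  by congr (\det _); apply/matrixP => i j; rewrite !mxE /= !bump_small.
rewrite /cofactor (expand_det_col _ ord_max) big_ord_recr /= big1 ?add0r => [|i _].
  rewrite !mxE /= /bump leqnn ltnn /= add1n add0n band_upper.
  rewrite addSn -signr_odd /= addnn odd_double expr1 mulN1r mulrN mulrCA mulrA.
  congr (- (_ * _)); rewrite /cofactor -signr_odd addnn odd_double mul1r -IH//.
  congr (\det _); apply/matrixP => i j; rewrite !mxE /=.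
  by rewrite !(bump_small (ltn_ord _)) bump_small// ltnS ltnW.
by rewrite !mxE /= bump_small ?ltnS 1?ltnW// /bump leqnn band_far ?mul0r// add1n !ltnS ltn_ord.
Qed.

Lemma det_add_delta n (A : 'M[K]_n) x i j :
  \det (A + x *: delta_mx i j) = \det A + x * cofactor A i j.
Proof.
have cof k : cofactor (A + x *: delta_mx i j) i k = cofactor A i k.
  rewrite /cofactor; congr (_ * \det _); apply/matrixP => i' j'.
  by rewrite !mxE eq_sym (negPf (neq_lift _ _)) mulr0 addr0.
rewrite !(expand_det_row _ i) (eq_bigr _ (fun k _ => congr1 _ (cof k))).
under eq_bigr => k _ do rewrite !mxE eqxx /= mulrDl.
rewrite big_split /=; congr (_ + _); rewrite (bigD1 j)//= eqxx mulr1.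
by rewrite big1 ?addr0// => k /negPf ->; rewrite mulr0 mul0r.
Qed.

(** Deleting the first row and the last column moves the subdiagonal [c] onto the diagonal of a
    triangular minor. *)
Lemma cofactor_tridiag_lower n a b c :
  cofactor (tridiag n.+1 a b c) 0 ord_max = (-1) ^+ n * \prod_(i < n) c i.
Proof.
rewrite /cofactor add0n -det_tr det_trig.
  congr (_ * _); apply: eq_bigr => i _; rewrite !mxE /= (bump_small (ltn_ord i)).
  exact: band_lower.
apply/is_trig_mxP => i j lt_ij; rewrite !mxE /= (bump_small (ltn_ord i)).
by rewrite band_far// /bump leq0n add1n !ltnS lt_ij orbT.
Qed.

Lemma cofactor_tridiag_upper n a b c :
  cofactor (tridiag n.+1 a b c) ord_max 0 = (-1) ^+ n * \prod_(i < n) b i.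
Proof.
rewrite /cofactor addn0 det_trig.
  congr (_ * _); apply: eq_bigr => i _; rewrite !mxE /= (bump_small (ltn_ord i)).
  exact: band_upper.
apply/is_trig_mxP => i j lt_ij; rewrite !mxE /= (bump_small (ltn_ord i)).
by rewrite band_far// /bump leq0n add1n !ltnS lt_ij.
Qed.

(** The determinant is affine in each corner entry. The linear terms are the two full cycles; the
    mixed coefficient is, up to sign, the minor without the first and last rows and columns. The
    point is that [k] is fixed before [x] and [y]. *)
Lemma det_tridiag_corners n a b c :
  exists k, forall x y,
    \det (tridiag n.+2 a b c + x *: delta_mx ord_max 0 + y *: delta_mx 0 ord_max)
    = \det (tridiag n.+2 a b c)
      + (-1) ^+ n.+1 * (x * \prod_(i < n.+1) b i + y * \prod_(i < n.+1) c i)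
      + x * y * k.
Proof.
exists ((-1) ^+ n.+1 * cofactor (row' 0 (col' ord_max (tridiag n.+2 a b c))) ord_max 0).
move=> x y; rewrite det_add_delta det_add_delta cofactor_tridiag_upper.
suff -> : cofactor (tridiag n.+2 a b c + x *: delta_mx ord_max 0) 0 ord_max =
    cofactor (tridiag n.+2 a b c) 0 ord_max
    + x * ((-1) ^+ n.+1 * cofactor (row' 0 (col' ord_max (tridiag n.+2 a b c))) ord_max 0).
  by rewrite cofactor_tridiag_lower; ring.
rewrite /cofactor add0n mulrCA -mulrDr; congr (_ * _).
rewrite -det_add_delta; congr (\det _); apply/matrixP => i j.
by rewrite !mxE -!val_eqE /= (bump_small (ltn_ord j)) /bump leq0n add1n eqSS.
Qed.

Lemma cyclicE n a b c :
  cyclic n.+1 a b c =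
  tridiag n.+1 a b c + b n *: delta_mx ord_max 0 + c n *: delta_mx 0 ord_max.
Proof.
apply/matrixP => i j; rewrite !mxE -!val_eqE /=.
(* The cyclic successor differs from [k.+1] only at the last index, which wraps to 0; this produces
   the corner entry. *)
have corner (k l : 'I_n.+1) (f : nat -> K) :
    f k *+ (l == (k.+1 %% n.+1)%N :> nat)
    = f k *+ (l == k.+1 :> nat) + f n * ((k == n :> nat) && (l == 0%N :> nat))%:R.
  have := ltn_ord k; rewrite ltnS leq_eqVlt => /orP[/eqP ->|lt_kn].
    by rewrite modnn eqxx /= (ltn_eqF (ltn_ord l)) add0r mulr_natr.
  by rewrite modn_small// (ltn_eqF lt_kn) mulr0 addr0.
by rewrite /band !corner (andbC (j == n :> nat)); ring.
Qed.

Lemma eq_tridiag n a b c b' c' :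
  (forall i, (i.+1 < n)%N -> b i = b' i) -> (forall i, (i.+1 < n)%N -> c i = c' i) ->
  tridiag n a b c = tridiag n a b' c'.
Proof.
move=> eq_b eq_c; apply/matrixP => i j; rewrite !mxE /band.
congr (_ + _ + _).
  by case: eqP => // eq_ji; rewrite eq_b// -eq_ji.
by case: eqP => // eq_ij; rewrite eq_c// -eq_ij.
Qed.

End Determinants.

Lemma char_poly_mx_cyclic (K : comNzRingType) n (a b c : nat -> K) :
  char_poly_mx (cyclic n a b c) =
  cyclic n (fun k => 'X - (a k)%:P) (fun k => - (b k)%:P) (fun k => - (c k)%:P).
Proof.
apply/matrixP => i j; rewrite !mxE !rmorphD /= !rmorphMn /=.
by rewrite mulrnBl !mulNrn !opprD !addrA.
Qed.

(* The characteristic polynomial of a cyclic band matrix involves the two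
   corner entries only through their product and through the two cycle
   products. *)
Lemma char_poly_cyclic (K : comNzRingType) n (a b c : nat -> K) :
  exists k : {poly K}, forall b' c' : nat -> K,
    (forall i, (i < n.+1)%N -> b' i = b i) ->
    (forall i, (i < n.+1)%N -> c' i = c i) ->
    char_poly (cyclic n.+2 a b' c') =
    \det (tridiag n.+2 (fun i => 'X - (a i)%:P) (fun i => - (b i)%:P)
                                                (fun i => - (c i)%:P))
    - (\prod_(i < n.+2) b' i + \prod_(i < n.+2) c' i)%:P
    + (b' n.+1 * c' n.+1)%:P * k.
Proof.
have [k kP] := det_tridiag_corners n (fun i => 'X - (a i)%:P) (fun i => - (b i)%:P)
  (fun i => - (c i)%:P).
exists k => b' c' eq_b eq_c; rewrite /char_poly char_poly_mx_cyclic cyclicE.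
rewrite (eq_tridiag _ (b' := fun i => - (b i)%:P) (c' := fun i => - (c i)%:P)); first last.
- by move=> i lt_i; rewrite eq_c.
- by move=> i lt_i; rewrite eq_b.
rewrite kP; congr (_ + _ + _); last by rewrite mulrNN polyCM.
have prod_recr (f g : nat -> K) : (forall i, (i < n.+1)%N -> f i = g i) ->
    \prod_(i < n.+2) f i = (\prod_(i < n.+1) g i) * f n.+1.
  move=> eq_fg; rewrite big_ord_recr; congr (_ * _).
  by apply: eq_bigr => i _; exact: eq_fg (ltn_ord i).
rewrite (prod_recr _ _ eq_b) (prod_recr _ _ eq_c).
rewrite !prodrN !card_ord polyCD !polyCM !rmorph_prod /=.
(* The sign [s] occurs twice, from the cofactor and from the [n.+1] negated entries; what survives
   is the sign of the negated corner entry. *)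
have := sqrr_sign {poly K} n.+1; set s := (-1) ^+ _ => s2.
set B := \prod_(i < _) (b i)%:P; set C := \prod_(i < _) (c i)%:P.
by rewrite -[RHS]mul1r -s2; ring.
Qed.

(** A vanishing product on the closing bond turns the ring into a path, except that a cycle product
    may still survive, since only one of the two corner entries has to vanish. *)
Lemma char_poly_cyclic_cut (K : comNzRingType) n (b c : nat -> K) :
  b n.+1 * c n.+1 = 0 ->
  char_poly (cyclic n.+2 (fun=> 0) b c) =
  continuant 'X (fun i => (b i * c i)%:P) n.+2
  - (\prod_(i < n.+2) b i + \prod_(i < n.+2) c i)%:P.
Proof.
move=> bc0; have [k ->//] := char_poly_cyclic n (fun=> 0) b c.
rewrite bc0 mul0r addr0 subr0 det_tridiag; congr (_ - _).
by apply: eq_continuant => i _; rewrite mulrNN polyCM.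
Qed.

(** * Unit complex numbers and roots of unity *)

Section UnitComplex.
Variable R : realType.
Implicit Types (x y : R) (n k : nat).

Lemma expiD x y : expi (x + y) = expi x * expi y.
Proof. by rewrite /expi cosD sinD; simpc; rewrite [sin x * _ + _]addrC. Qed.

Lemma expi0 : expi 0 = 1 :> R[i].
Proof. by rewrite /expi cos0 sin0. Qed.

Lemma expi_neq0 x : expi x != 0.
Proof.
apply/eqP => ex0; have := expiD x (- x).
by rewrite subrr expi0 ex0 mul0r => /eqP; rewrite oner_eq0.
Qed.

Lemma expiN x : expi (- x) = (expi x)^-1.
Proof.
by apply: (mulfI (expi_neq0 x)); rewrite -expiD subrr expi0 divff// expi_neq0.
Qed.

Lemma conjc_expi x : (expi x)^*%C = (expi x)^-1.
Proof. by rewrite -expiN /expi /= cosN sinN. Qed.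

Lemma expiMn n x : expi (n%:R * x) = expi x ^+ n.
Proof.
elim: n => [|n IH]; first by rewrite mul0r expi0.
by rewrite -natr1 mulrDl mul1r expiD IH exprSr.
Qed.

Lemma expi_pi : expi pi = -1 :> R[i].
Proof. by rewrite /expi cospi sinpi; simpc. Qed.

Lemma expi_pihalf : expi (pi / 2) = 'i :> R[i].
Proof. by rewrite /expi cos_pihalf sin_pihalf. Qed.

Lemma expi_2pi : expi (2 * pi) = 1 :> R[i].
Proof. by rewrite mulr_natl mulr2n expiD expi_pi mulrNN mulr1. Qed.

Lemma expiD2pi x n : expi (x + n%:R * (2 * pi)) = expi x.
Proof. by rewrite expiD expiMn expi_2pi expr1n mulr1. Qed.

Lemma cos_expi x : (cos x)%:C = (expi x + expi (- x)) / 2.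
Proof.
apply: (mulIf (_ : (2 : R[i]) != 0)); first by rewrite pnatr_eq0.
by rewrite divfK ?pnatr_eq0// /expi cosN sinN -[2]/(2%:R) mulr_natr mulr2n; simpc.
Qed.

Lemma expi_eq1 x : 0 < x < 2 * pi -> expi x != 1.
Proof.
move=> /andP[x0 x2pi]; apply/eqP => ex1.
have s_gt0 : 0 < sin (x / 2) by apply: sin_gt0_pi; lra.
have : expi (x / 2) - expi (- (x / 2)) = 0.
  have -> : expi (x / 2) = expi (- (x / 2)) * expi x by rewrite -expiD; congr expi; field.
  by rewrite ex1 mulr1 subrr.
by move=> /(congr1 (@complex.Im R)); rewrite /expi cosN sinN /=; lra.
Qed.

Lemma expi_primitive N : (0 < N)%N -> N.-primitive_root (expi (2 * pi / N%:R) : R[i]).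
Proof.
move=> N0; have Nne0 : N%:R != 0 :> R by rewrite pnatr_eq0 -lt0n.
have zN : (expi (2 * pi / N%:R) : R[i]) ^+ N = 1.
  by rewrite -expiMn mulrC divfK// expi_2pi.
have [m mprim mN] := prim_order_exists N0 zN.
suff eNm : N = m by rewrite {1}eNm.
have m0 : (0 < m)%N := prim_order_gt0 mprim.
apply/eqP; rewrite eqn_leq (dvdn_leq N0 mN) andbT leqNgt; apply/negP => lt_mN.
have /eqP := prim_expr_order mprim; rewrite -expiMn; apply/negP/expi_eq1.
have pi0 := @pi_gt0 R.
have N0R : 0 < N%:R :> R by rewrite ltr0n.
apply/andP; split; first by rewrite mulr_gt0 ?divr_gt0 ?ltr0n// mulr_gt0.
by rewrite [_ * (_ / _)]mulrA ltr_pdivrMr// mulrC ltr_pM2l ?ltr_nat// mulr_gt0.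
Qed.

(** Evaluate the factorization of [X^N - 1] over the N-th roots of unity at [- expi (- y)]. *)
Lemma prod_1D_roots N y : (0 < N)%N ->
  \prod_(k < N) (1 + expi (y + 2 * pi * k%:R / N%:R)) = 1 - (- expi y) ^+ N :> R[i].
Proof.
move=> N0; have prim := expi_primitive N0.
have rootE k : expi (- y) + expi (2 * pi / N%:R) ^+ k =
    expi (- y) * (1 + expi (y + 2 * pi * k%:R / N%:R)).
  rewrite -expiMn (mulrDr (expi (- y))) mulr1 -expiD; congr (_ + expi _).
  by rewrite addKr mulrC mulrAC.
have := congr1 (fun p => p.[- expi (- y)]) (factor_Xn_sub_1 prim).
rewrite big_mkord horner_prod !hornerE /=.
under eq_bigr => k _ do rewrite !hornerE -opprD rootE -mulNr.
rewrite big_split /= prodr_const card_ord => prodE.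
apply: (mulfI (_ : (- expi (- y)) ^+ N != 0)).
  by rewrite expf_neq0// oppr_eq0 expi_neq0.
by rewrite prodE mulrBr mulr1 -exprMn mulrNN -expiD addNr expi0 expr1n.
Qed.

End UnitComplex.

(** * Products with cyclic band matrices, and similarity *)

Section Cyclic.
Variable K : comNzRingType.
Implicit Types (a b c : nat -> K).

Lemma sum_delta n (f : 'I_n -> K) i : \sum_j f j *+ (j == i) = f i.
Proof.
by rewrite (bigD1 i)//= eqxx big1 ?addr0// => j /negPf ->.
Qed.

Lemma eq_ordS n (i j : 'I_n) : (i == ordS j) = (j == ord_pred i).
Proof. by rewrite eq_sym (can2_eq (@ordSK n) (@ord_predK n)). Qed.

Lemma mul_cyclic_mx n a b c (M : 'M_n) i k :
  (cyclic n a b c *m M) i k =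
  a i * M i k + b i * M (ordS i) k + c (ord_pred i) * M (ord_pred i) k.
Proof.
rewrite mxE.
under eq_bigr => j _ do rewrite mxE !mulrDl !mulrnAl (eq_sym i j) (eq_ordS i).
by rewrite !big_split /= !sum_delta.
Qed.

Lemma mul_mx_cyclic m n a b c (M : 'M_(m, n)) i k :
  (M *m cyclic n a b c) i k =
  M i k * a k + M i (ord_pred k) * b (ord_pred k) + M i (ordS k) * c k.
Proof.
rewrite mxE.
under eq_bigr => j _ do rewrite mxE !mulrDr !mulrnAr (eq_ordS k).
by rewrite !big_split /= !sum_delta.
Qed.

Lemma char_poly_intertwine (F : fieldType) n (A B M : 'M[F]_n) :
  M \in unitmx -> A *m M = M *m B -> char_poly A = char_poly B.
Proof.
move=> uM AM; rewrite /char_poly.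
have uM' : map_mx polyC M \in unitmx by rewrite map_unitmx.
have detM : \det (map_mx polyC M) != 0.
  by move: uM'; rewrite unitmxE; apply: contraTneq => ->; rewrite unitr0.
apply: (mulIf detM); rewrite [RHS]mulrC -!det_mulmx; congr (\det _).
by rewrite /char_poly_mx mulmxBl mulmxBr -!map_mxM AM scalar_mxC.
Qed.

End Cyclic.

(** * The operator as a cyclic band matrix *)

Section Harper.
Variable R : realType.
Implicit Types (phi theta eta kappa : R) (N : nat).

Definition twist N (tau : R[i]) (j : nat) : R[i] := if j.+1 == N then tau else 1.

Lemma twisted_shiftE N tau :
  twisted_shift N tau = cyclic N (fun=> 0) (fun=> 0) (twist N tau).
Proof.
apply/matrixP => i j; rewrite !mxE !mul0rn !add0r -val_eqE /= /twist.
case: eqP => [->|/eqP neq_jN].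
  by rewrite modnn; case: eqP.
by rewrite modn_small// ltn_neqAle neq_jN ltn_ord.
Qed.

Lemma invmx_twisted_shift N (tau : R[i]) : tau != 0 ->
  invmx (twisted_shift N tau) = cyclic N (fun=> 0) (twist N tau^-1) (fun=> 0).
Proof.
move=> tau0; set S := twisted_shift N tau; set S' := cyclic _ _ _ _.
have SS' : S *m S' = 1%:M.
  apply/matrixP => i k; rewrite /S twisted_shiftE mul_cyclic_mx !mul0r !add0r !mxE.
  rewrite !mul0rn add0r addr0 ord_predK eq_sym mulrnAr /twist.
  by case: eqP => _; rewrite ?mulr1// divff.
have [uS _] := mulmx1_unit SS'.
by rewrite -[S']mul1mx -(mulVmx uS) -mulmxA SS' mulmx1.
Qed.

Lemma opAE N (tau : R[i]) phi theta : tau != 0 ->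
  opA N tau phi theta =
  cyclic N (fun j => (cos (2 * pi * j%:R / N%:R + theta))%:C)
    (fun j => expi phi / 2 * twist N tau^-1 j) (fun j => expi phi / 2 * twist N tau j).
Proof.
move=> tau0; rewrite /opA invmx_twisted_shift// twisted_shiftE.
apply/matrixP => i j; rewrite !mxE !mul0rn !add0r addr0 mulrDr !mulrnAr.
rewrite addrC -addrA [in RHS](addrC (_ *+ (j == _))) addrA.
by case: eqP => [->|_] //.
Qed.

End Harper.

(** * The eigenbasis of [W], the Chambers formula and the reduction to a path *)

Section Chambers.
Local Arguments conjc : simpl never.
Variable R : realType.
Implicit Types (phi theta eta kappa : R) (N : nat).

Lemma ordS_cases N (i : 'I_N) :
  (ordS i = i.+1 :> nat /\ (i.+1 == N) = false) \/ (ordS i = 0%N :> nat /\ i.+1 = N).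
Proof.
rewrite /=; have := ltn_ord i; rewrite leq_eqVlt => /orP[/eqP eN|lt_iN].
  by right; split=> //; rewrite eN modnn.
by left; rewrite modn_small// ltn_eqF.
Qed.

(* Writing W = S^-1 V with S = S_tau and V = diag(e^{i (2 pi j / N + theta)}),
   the k-th column is an eigenvector of W, with eigenvalue
   e^{i (eta + 2 pi k / N)}; S maps it to a multiple of the next one. *)
Definition gauge_phase N theta eta (x y : R) : R :=
  x * (eta - theta) + 2 * pi * x * y / N%:R - pi * x * (x + 1) / N%:R.

Definition gauge_mx N theta eta : 'M[R[i]]_N :=
  \matrix_(j, k) expi (gauge_phase N theta eta j%:R k%:R).

(** [W^N] is the scalar e^{i (N theta + (N - 1) pi)} / tau, so an eigenvalue e^{i eta} of [W] forces
    this twist modulo 2 pi. *)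
Definition gauge_twist N theta eta : R := N%:R * (theta - eta) + (N%:R + 1) * pi.

(** Both [V^-1] and [e^{i phi} S^-1] carry column [k + 1] to a multiple of column [k], which gives
    the two summands of the upper entry; [V] and [e^{i phi} S] go the other way and give the lower
    one. *)
Definition chiral_upper N phi theta eta (k : R) : R[i] :=
  expi (- theta) / 2 * (1 + expi (phi + eta + 2 * pi * k / N%:R)).

Definition chiral_lower N phi theta eta (k : R) : R[i] :=
  expi theta / 2 * (1 + expi (phi - eta - 2 * pi * k / N%:R)).

(** Up to a diagonal matrix of phases this is the Vandermonde matrix of the N-th roots of unity. *)
Lemma gauge_mx_unit N theta eta : (0 < N)%N -> gauge_mx N theta eta \in unitmx.
Proof.
move=> N0; have N0R : N%:R != 0 :> R by rewrite pnatr_eq0 -lt0n.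
have prim := expi_primitive R N0; set w := expi _ in prim.
have -> : gauge_mx N theta eta =
    diag_mx (\row_j expi (gauge_phase N theta eta j%:R 0)) *m
    Vandermonde N (\row_k w ^+ k).
  apply/matrixP => j k; rewrite mul_diag_mx !mxE -exprM mulnC -!expiMn -expiD.
  by congr expi; rewrite natrM /gauge_phase; field.
rewrite unitmx_mul !unitmxE det_diag det_Vandermonde; apply/andP; split.
  by rewrite unitfE; apply/prodf_neq0 => j _; rewrite mxE expi_neq0.
rewrite unitfE; apply/prodf_neq0 => j _; apply/prodf_neq0 => k lt_jk.
rewrite !mxE subr_eq0 (eq_prim_root_expr prim) !modn_small ?ltn_ord//.
by rewrite gtn_eqF.
Qed.

Lemma gauge_mx_intertwine N phi theta eta : (0 < N)%N ->
  opA N (expi (gauge_twist N theta eta)) phi theta *m gauge_mx N theta eta =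
  gauge_mx N theta eta *m
    cyclic N (fun=> 0) (fun k => chiral_upper N phi theta eta k%:R)
                       (fun k => chiral_lower N phi theta eta k%:R).
Proof.
move=> N0; have N0R : N%:R != 0 :> R by rewrite pnatr_eq0 -lt0n.
pose m x y : R[i] := expi (gauge_phase N theta eta x y).
have last_ord (i : 'I_N) : i.+1 = N -> i%:R = N%:R - 1 :> R.
  by move=> E; apply: (addIr 1); rewrite natr1 E subrK.
(* The twist at the wrap-around compensates exactly for [m] not being periodic in the row index; in
   the column index [m] is periodic. All cyclic successors thus become plain shifts by 1. *)
have rowS (i k : 'I_N) : twist N (expi (gauge_twist N theta eta))^-1 i * m (ordS i)%:R k%:R
    = m (i%:R + 1) k%:R.
  rewrite /twist; case: (ordS_cases i) => -[-> E]; rewrite ?E ?eqxx.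
    by rewrite mul1r -natr1.
  rewrite -expiN -expiD (last_ord _ E) -[LHS](expiD2pi _ k).
  by congr expi; rewrite /gauge_phase /gauge_twist; field.
have rowP (j k : 'I_N) : twist N (expi (gauge_twist N theta eta)) j * m j%:R k%:R
    = m ((ordS j)%:R - 1) k%:R.
  rewrite /twist; case: (ordS_cases j) => -[-> E]; rewrite ?E ?eqxx.
    by rewrite mul1r -natr1 addrK.
  rewrite -expiD (last_ord _ E) -[RHS](expiD2pi _ k.+1) -natr1.
  by congr expi; rewrite /gauge_phase /gauge_twist; field.
have colS (i k : 'I_N) : m i%:R (ordS k)%:R = m i%:R (k%:R + 1).
  case: (ordS_cases k) => -[-> E]; first by rewrite -natr1.
  rewrite (last_ord _ E) -[LHS](expiD2pi _ i).
  by congr expi; rewrite /gauge_phase; field.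
have colP (i l : 'I_N) : m i%:R l%:R = m i%:R ((ordS l)%:R - 1).
  case: (ordS_cases l) => -[-> E]; first by rewrite -natr1 addrK.
  rewrite (last_ord _ E) -[RHS](expiD2pi _ i).
  by congr expi; rewrite /gauge_phase; field.
have upperP (l : 'I_N) : chiral_upper N phi theta eta l%:R =
    chiral_upper N phi theta eta ((ordS l)%:R - 1).
  case: (ordS_cases l) => -[-> E]; first by rewrite -natr1 addrK.
  rewrite (last_ord _ E); congr (_ * (1 + _)); rewrite -[RHS](expiD2pi _ 1).
  by congr expi; field.
have gaugeE (i k : 'I_N) : gauge_mx N theta eta i k = m i%:R k%:R by rewrite mxE.
rewrite opAE ?expi_neq0//; apply/matrixP => i k.
rewrite mul_cyclic_mx mul_mx_cyclic mulr0 add0r !gaugeE.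
rewrite -[_ * _^-1 * twist _ _^-1 _ * _]mulrA rowS.
rewrite -[_ * _^-1 * twist _ _ _ * _]mulrA rowP ord_predK.
rewrite colS (colP _ (ord_pred k)) (upperP (ord_pred k)) ord_predK cos_expi.
move: (i%:R) (k%:R) => x y.
(* Each of the four summands of the operator moves the column index by exactly one, so no diagonal
   term arises. *)
have V_up : expi (2 * pi * x / N%:R + theta) * m x y = expi theta * m x (y + 1).
  by rewrite -!expiD; congr expi; rewrite /gauge_phase; field.
have V_low : expi (- (2 * pi * x / N%:R + theta)) * m x y = expi (- theta) * m x (y - 1).
  by rewrite -!expiD; congr expi; rewrite /gauge_phase; field.
have S_up : expi phi * m (x + 1) y =
    expi (- theta) * expi (phi + eta + 2 * pi * (y - 1) / N%:R) * m x (y - 1).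
  by rewrite -!expiD; congr expi; rewrite /gauge_phase; field.
have S_low : expi phi * m (x - 1) y =
    expi theta * expi (phi - eta - 2 * pi * y / N%:R) * m x (y + 1).
  by rewrite -!expiD; congr expi; rewrite /gauge_phase; field.
transitivity ((expi (2 * pi * x / N%:R + theta) * m x y
    + expi (- (2 * pi * x / N%:R + theta)) * m x y
    + expi phi * m (x + 1) y + expi phi * m (x - 1) y) / 2); first by ring.
by rewrite V_up V_low S_up S_low /chiral_upper /chiral_lower; field.
Qed.

Lemma chi_chiral N phi theta eta : (0 < N)%N ->
  chi N (expi (gauge_twist N theta eta)) phi theta =
  char_poly (cyclic N (fun=> 0) (fun k => chiral_upper N phi theta eta k%:R)
                                (fun k => chiral_lower N phi theta eta k%:R)).
Proof.
move=> N0; apply: char_poly_intertwine (gauge_mx_intertwine _ _ _ N0).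
exact: gauge_mx_unit.
Qed.

(** The constants of the Chambers formula are added back to [chi]; the formula asserts that the
    result is free of [theta] and [kappa]. *)
Definition chambers N phi theta kappa : {poly R[i]} :=
  chi N (expi kappa) phi theta
  + (2 ^- N.-1 * ((cos (N%:R * theta))%:C + expi (N%:R * phi) * (cos kappa)%:C))%:P.

Lemma chambersE N phi theta kappa :
  chambers N.+1 phi theta kappa = chi N.+1 (expi kappa) phi theta
  + (2 ^- N.+1 * (expi (N.+1%:R * theta) + expi (- (N.+1%:R * theta))
      + expi (N.+1%:R * phi) * (expi kappa + expi (- kappa))))%:P.
Proof.
rewrite /chambers !cos_expi /= exprS; congr (_ + _%:P); field.
by rewrite expf_neq0 ?pnatr_eq0.
Qed.

(** The twist enters only through the corner entries: their product is free of it, and the two cycle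
    products contribute exactly the cos kappa term. *)
Lemma chambers_twist N phi theta kappa kappa' :
  chambers N.+2 phi theta kappa = chambers N.+2 phi theta kappa'.
Proof.
pose b (tau : R[i]) := fun j => expi phi / 2 * twist N.+2 tau j.
have [k kP] := char_poly_cyclic N
  (fun j => (cos (2 * pi * j%:R / N.+2%:R + theta))%:C) (b 1) (b 1).
have b_in tau i : (i < N.+1)%N -> b tau i = b 1 i.
  by rewrite /b /twist eqSS => /ltn_eqF ->.
have b1 i : b 1 i = expi phi / 2 by rewrite /b /twist; case: eqP; rewrite mulr1.
have prod_b tau : \prod_(i < N.+2) b tau i = 2 ^- N.+2 * expi (N.+2%:R * phi) * tau.
  rewrite big_ord_recr /= {2}/b /twist eqxx.
  rewrite (eq_bigr (fun=> expi phi / 2)); last first.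
    by move=> i _; rewrite -(b1 i); exact: b_in (ltn_ord i).
  rewrite prodr_const card_ord mulrA -exprSr expr_div_n expiMn.
  by rewrite [expi phi ^+ _ / _]mulrC.
have corner tau : tau != 0 -> b tau^-1 N.+1 * b tau N.+1 = (expi phi / 2) ^+ 2.
  by move=> tau0; rewrite /b /twist eqxx mulrACA mulVf// mulr1 expr2.
suff chambers_const kap : chambers N.+2 phi theta kap =
  \det (tridiag N.+2 (fun i => 'X - (cos (2 * pi * i%:R / N.+2%:R + theta))%:C%:P)
          (fun i => - (b 1 i)%:P) (fun i => - (b 1 i)%:P))
  + ((expi phi / 2) ^+ 2)%:P * k
  + (2 ^- N.+2 * (expi (N.+2%:R * theta) + expi (- (N.+2%:R * theta))))%:P.
  by rewrite !chambers_const.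
rewrite chambersE /chi opAE ?expi_neq0// (kP (b (expi kap)^-1) (b (expi kap)))//.
- rewrite !prod_b corner ?expi_neq0// -expiN !mulrDr !polyCD -!mulrA !polyCM; ring.
- exact: b_in.
- exact: b_in.
Qed.

Definition hop N phi (k : nat) : R :=
  sin (phi + pi * k.+1%:R / N%:R) * sin (pi * k.+1%:R / N%:R).

(* The phase for which the corner entry [chiral_lower] at [k = N - 1] vanishes. *)
Definition cut_phase N phi : R := phi + pi + 2 * pi / N%:R.

Lemma expi1D (x : R) : 1 + expi x = 2 * (cos (x / 2))%:C * expi (x / 2).
Proof.
rewrite cos_expi mulrC [2 * _]mulrC divfK ?pnatr_eq0// mulrDr -!expiD subrr expi0.
by rewrite addrC; congr (expi _ + _); field.
Qed.

(** Half-angle formulas turn both factors into cosines; the cut phase shifts these to sines, and the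
    remaining phases combine to e^{i phi}. *)
Lemma chiral_hop N phi theta k : (0 < N)%N ->
  chiral_upper N phi theta (cut_phase N phi) k%:R
  * chiral_lower N phi theta (cut_phase N phi) k%:R = expi phi * (hop N phi k)%:C.
Proof.
move=> N0; have N0R : N%:R != 0 :> R by rewrite pnatr_eq0 -lt0n.
rewrite /chiral_upper /chiral_lower /hop /cut_phase !expi1D.
set s := pi * k.+1%:R / N%:R.
have -> : (phi + (phi + pi + 2 * pi / N%:R) + 2 * pi * k%:R / N%:R) / 2
   = (phi + s) + pi / 2 by rewrite /s -natr1; field.
have -> : (phi - (phi + pi + 2 * pi / N%:R) - 2 * pi * k%:R / N%:R) / 2
   = - (s + pi / 2) by rewrite /s -natr1; field.
rewrite cosN !cosDpihalf !rmorphN rmorphM /=.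
transitivity (expi (- theta) * expi theta * (expi (phi + s + pi / 2) * expi (- (s + pi / 2)))
  * (sin (phi + s))%:C * (sin s)%:C); first by field.
rewrite -expiD addNr expi0 mul1r -expiD -mulrA; congr (expi _ * _); ring.
Qed.

Lemma prod_chiral_upper N phi theta eta : (0 < N)%N ->
  \prod_(k < N) chiral_upper N phi theta eta k%:R =
  2 ^- N * (expi (- (N%:R * theta))
            - (-1) ^+ N * expi (N%:R * phi) * expi (N%:R * (eta - theta))).
Proof.
move=> N0; rewrite big_split /= prodr_const card_ord prod_1D_roots//.
rewrite expr_div_n [(- expi _) ^+ _]exprNn -!expiMn mulrAC mulrC -[in RHS]mulrA -expiD mulrBr mulr1.
rewrite mulrCA -expiD; congr (_ * (expi _ - _ * expi _)); ring.
Qed.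

Lemma prod_chiral_lower N phi theta eta : (0 < N)%N ->
  \prod_(k < N) chiral_lower N phi theta eta k%:R =
  2 ^- N * (expi (N%:R * theta)
            - (-1) ^+ N * expi (N%:R * phi) * expi (N%:R * (theta - eta))).
Proof.
move=> N0; rewrite big_split /= prodr_const card_ord.
(* The angles run backwards here, so this is the conjugate of [prod_1D_roots] at [eta - phi]. *)
have -> : \prod_(k < N) (1 + expi (phi - eta - 2 * pi * k%:R / N%:R)) =
    1 - (- expi (phi - eta)) ^+ N :> R[i].
  have := congr1 conjc (prod_1D_roots (eta - phi) N0).
  rewrite rmorph_prod rmorphB rmorphXn rmorphN rmorph1 /=.
  rewrite conjc_expi -expiN opprB => <-.
  apply: eq_bigr => k _; rewrite rmorphD rmorph1 /= conjc_expi -expiN.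
  by congr (_ + expi _); ring.
rewrite expr_div_n [(- expi _) ^+ _]exprNn -!expiMn mulrAC mulrC -[in RHS]mulrA -expiD mulrBr mulr1.
rewrite mulrCA -expiD; congr (_ * (expi _ - _ * expi _)); ring.
Qed.

Lemma expi_gauge_twist N theta eta :
  expi (gauge_twist N theta eta) = - ((-1) ^+ N * expi (N%:R * (theta - eta))).
Proof.
by rewrite /gauge_twist natr1 expiD (expiMn N.+1) expi_pi exprS mulN1r mulrN mulrC.
Qed.

Lemma expi_gauge_twistN N theta eta :
  expi (- gauge_twist N theta eta) = - ((-1) ^+ N * expi (N%:R * (eta - theta))).
Proof.
rewrite -expi_gauge_twist -[LHS](expiD2pi _ N.+1); congr expi.
by rewrite /gauge_twist -natr1; ring.
Qed.

(** Trade [kappa] for the twist belonging to the cut phase: the ring opens into a path, and its two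
    cycle products cancel the added constants. The right side is free of [theta] and [kappa], which
    is the Chambers formula. *)
Lemma chambers_continuant N phi theta kappa :
  chambers N.+2 phi theta kappa =
  continuant 'X (fun k => (expi phi * (hop N.+2 phi k)%:C)%:P) N.+2.
Proof.
rewrite (chambers_twist _ _ _ _ (gauge_twist N.+2 theta (cut_phase N.+2 phi))).
rewrite chambersE chi_chiral// char_poly_cyclic_cut; last first.
  (* At the closing bond [k = N.+1] the angle is exactly pi, whose sine vanishes. *)
  rewrite chiral_hop// /hop mulfK ?pnatr_eq0//.
  by rewrite sinpi mulr0 rmorph0 mulr0.
rewrite prod_chiral_upper// prod_chiral_lower// expi_gauge_twist expi_gauge_twistN.
rewrite -addrA -polyCN -polyCD [X in _ + X%:P](_ : _ = 0) ?addr0; last by ring.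
by apply: eq_continuant => k _; rewrite chiral_hop.
Qed.

Lemma Qpoly_chambers N phi : Qpoly N phi = chambers N phi 0 0.
Proof.
rewrite /Qpoly /chambers -addrA -polyCD expi0 mulr0 cos0 rmorph1 mulr1.
by rewrite mulrDr mulr1.
Qed.

End Chambers.

(** * Real-rootedness of the reduced continuant *)

Section RealRoots.
Variable R : realType.
Implicit Types (d : nat -> R) (w P p : R[i]) (n : nat).

(** The continuant as a polynomial in t = z^2 / a, stripped of its power of [a] and its parity
    factor in z: two factors z make one ['X], which therefore appears at every second step. See
    [continuantE]. *)
Fixpoint half_continuant d n : {poly R} :=
  if n is n'.+1 then
    (if odd n' then 'X else 1) * half_continuant d n'
    - (if n' is n''.+1 then d n'' *: half_continuant d n'' else 0)
  else 1.

Lemma half_continuantSS d n : half_continuant d n.+2 =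
  (if odd n.+1 then 'X else 1) * half_continuant d n.+1 - d n *: half_continuant d n.
Proof. by []. Qed.

Lemma half_continuant_monic d n :
  half_continuant d n \is monic /\ size (half_continuant d n) = n./2.+1.
Proof.
elim/ltn_ind: n => -[|[|n]] IH.
- by rewrite monic1 size_poly1.
- by rewrite /= mul1r subr0 monic1 size_poly1.
have [//|m1 s1] := IH n.+1; have [//|m0 s0] := IH n.
rewrite half_continuantSS; set q := _ * _; set r := _ *: _.
have m_q : q \is monic by rewrite monicMl//; case: ifP; rewrite ?monicX ?monic1.
have s_q : size q = n./2.+2.
  rewrite /q /=; case: ifP => [even_n|]; last first.
    by move=> /negbFE odd_n; rewrite mul1r s1 /= uphalf_half odd_n.
  rewrite mulrC size_mulX ?monic_neq0// s1 /= uphalf_half.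
  by rewrite (negPf even_n).
have lt_rq : (size (- r) < size q)%N.
  by rewrite size_polyN s_q; apply: leq_ltn_trans (size_scale_leq _ _) _; rewrite s0.
by rewrite qualifE/= lead_coefDl// size_polyDl// s_q; split.
Qed.

Lemma continuantE d n (a z : R[i]) : a != 0 ->
  continuant z (fun k => a * (d k)%:C) n =
  a ^+ n./2 * z ^+ odd n * (map_poly (real_complex R) (half_continuant d n)).[a^-1 * z ^+ 2].
Proof.
move=> a0; elim/ltn_ind: n => -[|[|n]] IH.
- by rewrite rmorph1 hornerC !expr0 !mul1r.
- by rewrite /= mul1r !subr0 rmorph1 hornerC expr0 expr1 !mulr1 mul1r.
rewrite continuantSS !IH// half_continuantSS.
move: (half_continuant d n.+1) (half_continuant d n) => p q.
rewrite rmorphB rmorphM /= map_polyZ /= uphalf_half hornerD hornerN hornerZ hornerM.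
case: (odd n) => /=; rewrite ?map_polyX ?rmorph1 ?hornerX ?hornerC ?expr0 ?exprS /=.
  by ring.
by field.
Qed.

(* With f = w P / p and g = P / (w p), this is the division-free form of
   Im f > 0 and e Im g >= 0. *)
Definition upper_pair w e P p : Prop :=
  0 < complex.Im (w * P * p^*%C) /\ 0 <= e * complex.Im (P * (w * p)^*%C).

Lemma Im_pos_neq0 w P p : 0 < complex.Im (w * P * p^*%C) -> P != 0.
Proof. by apply: contraTneq => ->; rewrite mulr0 mul0r ltxx. Qed.

(** The new ratios are f' = w^2 - x / g and g' = 1 - x / f, and inversion with a minus sign
    preserves the sign of the imaginary part. *)
Lemma upper_pairS (x : R) w e P p : e ^+ 2 = 1 -> 0 < complex.Im (w ^+ 2) -> 0 <= e * x ->
  upper_pair w e P p -> upper_pair w e (w * P - x%:C * p) P.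
Proof.
move=> e1 w2 ex [H1 H2]; have P0 := Im_pos_neq0 H1.
case: w P p w2 H1 H2 P0 => [w1 w2] [P1 P2] [p1 p2].
rewrite expr2 /upper_pair /=; set A := (X in _ -> 0 < X -> _); set B := (X in e * X).
move=> Iw2 A0 B0 P0.
have Ppos : 0 < P1 ^+ 2 + P2 ^+ 2.
  rewrite lt_neqAle addr_ge0 ?sqr_ge0// andbT eq_sym paddr_eq0 ?sqr_ge0// !sqrf_eq0.
  by move: P0; rewrite eq_complex.
have xB : 0 <= x * B.
  have -> : x * B = (e * x) * (e * B) by rewrite mulrACA -expr2 e1 mul1r.
  exact: mulr_ge0.
split.
  have := ltr_pwDl (mulr_gt0 Iw2 Ppos) xB; congr (_ < _); rewrite /B. ring.
have := mulr_ge0 ex (ltW A0); congr (_ <= _); rewrite /A; ring.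
Qed.

Lemma upper_continuant d w e n : e ^+ 2 = 1 -> 0 < complex.Im (w ^+ 2) ->
  (forall k, (k < n)%N -> 0 <= e * d k) ->
  upper_pair w e (continuant w (fun k => (d k)%:C) n.+1) (continuant w (fun k => (d k)%:C) n).
Proof.
move=> e1 w2; elim: n => [|n IH] ed.
  rewrite /= subr0 mulr1; case: w w2 => [w1 w2]; rewrite expr2 /upper_pair /= => w2_gt0.
  by split; [move: w2_gt0; congr (_ < _); ring|rewrite le_eqVlt; apply/orP; left; apply/eqP; ring].
rewrite continuantSS; apply: upper_pairS => //; first exact: ed.
by apply: IH => k lt_kn; apply/ed/ltnW.
Qed.

Lemma upper_continuant_rev d w e n : e ^+ 2 = 1 -> 0 < complex.Im (w ^+ 2) ->
  (forall k, (k < n)%N -> 0 <= e * d k) ->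
  upper_pair w e (continuant w (fun k => (d k)%:C) n.+1)
                 (continuant w (fun k => (d k.+1)%:C) n).
Proof.
move=> e1 w2; elim: n d => [|n IH] d ed; first exact: upper_continuant.
rewrite continuant_recl; apply: upper_pairS => //; first exact: ed.
by apply: IH => k lt_kn; apply: ed.
Qed.

(** Cut at bond [m]. A zero would mean w P / p = d_m / (Q / (w q)), with P, p from the left part and
    Q, q from the right part; the left side has positive imaginary part, the right side a
    nonpositive one because [e] changes sign across the cut. If [n <= m] there is no sign change and
    the left part is everything. *)
Lemma continuant_neq0 d w e m n : e ^+ 2 = 1 -> 0 < complex.Im (w ^+ 2) ->
  (forall k, (k < m)%N -> 0 <= e * d k) ->
  (forall k, (m <= k < n)%N -> e * d k <= 0) ->
  continuant w (fun k => (d k)%:C) n.+1 != 0.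
Proof.
move=> e1 w2 left_sign right_sign; case: (leqP n m) => [le_nm|lt_mn].
  suff [/Im_pos_neq0//] : upper_pair w e (continuant w (fun k => (d k)%:C) n.+1)
                                       (continuant w (fun k => (d k)%:C) n).
  by apply: upper_continuant => // k lt_kn; apply/left_sign/(leq_trans lt_kn).
have [l en] : exists l, n = (m.+1 + l)%N by exists (n - m.+1)%N; rewrite subnKC.
rewrite en -addnS continuant_cat.
have [] := upper_continuant e1 w2 left_sign.
move: (continuant w _ m.+1) (continuant w _ m) => P p HP _.
have Ne1 : (- e) ^+ 2 = 1 by rewrite sqrrN.
have right_sign' k : (k < l)%N -> 0 <= - e * d (m.+1 + k)%N.
  move=> lt_kl; rewrite mulNr oppr_ge0; apply: right_sign.
  by rewrite en ltn_add2l lt_kl andbT (leq_trans (leqnSn m)) ?leq_addr.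
have [] := upper_continuant_rev Ne1 w2 right_sign'.
rewrite (eq_continuant _ (e := fun k => (d (m.+1 + k.+1)%N)%:C)
  (e' := fun k => (d (m.+2 + k)%N)%:C)); last by move=> k _; rewrite -addSnnS.
move: (continuant w _ l.+1) (continuant w _ l) => Q q HQ HQ'.
have Q0 := Im_pos_neq0 HQ.
have Ned : 0 <= - e * d m by rewrite mulNr oppr_ge0 right_sign// leqnn lt_mn.
apply/negP; rewrite subr_eq0 => /eqP PQ.
have := mulr_ge0 Ned HQ'.
(* The equation of the two ratios, multiplied by the squared moduli of [p] and [Q], so that [p] and
   [q] may vanish. *)
have : w * P * p^*%C * (Q * Q^*%C) = (d m)%:C * (p * q * (w * p^*%C * Q^*%C)).
  transitivity (P * Q * (w * p^*%C * Q^*%C)); first by ring.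
  by rewrite PQ; ring.
case: w P p Q q {w2 left_sign right_sign PQ HQ HQ'} HP Q0 => [w1 w2] [P1 P2] [p1 p2] [Q1 Q2] [q1 q2].
move=> A0 Q0 /(congr1 (@complex.Im R)) + F; move: A0 F => /=.
set A := (X in 0 < X -> _); set I := (X in - e * d m * (- e * X)) => A0 F E.
have Qpos : 0 < Q1 ^+ 2 + Q2 ^+ 2.
  rewrite lt_neqAle addr_ge0 ?sqr_ge0// andbT eq_sym paddr_eq0 ?sqr_ge0// !sqrf_eq0.
  by move: Q0; rewrite eq_complex.
have dI : 0 <= d m * I by move: F; rewrite mulrACA mulrNN -expr2 e1 mul1r.
have dIp := mulr_ge0 dI (addr_ge0 (sqr_ge0 p1) (sqr_ge0 p2)).
have AQ := mulr_gt0 A0 Qpos.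
have : A * (Q1 ^+ 2 + Q2 ^+ 2) + d m * I * (p1 ^+ 2 + p2 ^+ 2) = 0.
  move/eqP: E; rewrite -subr_eq0 => /eqP E; rewrite -[RHS]E /A /I; ring.
by move=> AI0; move: (ltr_pwDl AQ dIp); rewrite AI0 ltxx.
Qed.

(** A root z in the upper half-plane would make the continuant vanish at a square root of z; the
    lower half-plane follows by conjugation, the coefficients being real. *)
Lemma half_continuant_real_rooted d e m n : e ^+ 2 = 1 ->
  (forall k, (k < m)%N -> 0 <= e * d k) ->
  (forall k, (m <= k < n)%N -> e * d k <= 0) ->
  real_rooted (half_continuant d n.+1).
Proof.
move=> e1 left_sign right_sign.
have upper z : 0 < complex.Im z ->
    ~~ root (map_poly (real_complex R) (half_continuant d n.+1)) z.
  move=> z_gt0; have w2 := sqr_sqrtc z; set w := sqrtc z in w2.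
  have := @continuant_neq0 d w e m n e1 _ left_sign right_sign.
  rewrite w2 => /(_ z_gt0); have := continuantE d n.+1 w (oner_neq0 R[i]).
  under eq_continuant do rewrite mul1r.
  by rewrite invr1 mul1r w2 rootE => ->; apply: contraNN => /eqP ->; rewrite mulr0.
move=> z rz; case: (ltrgt0P (complex.Im z)) => [z_gt0|z_lt0|z0].
- by move: (upper z z_gt0); rewrite rz.
- have /upper : 0 < complex.Im z^*%C by case: z z_lt0 {rz} => x y /=; rewrite oppr_gt0.
  rewrite -complex_root_conj -map_poly_comp.
  by rewrite (eq_map_poly (g := real_complex R)) ?rz// => x; exact: conjc_real.
- by exists (complex.Re z); case: z z0 {rz} => x y /= ->.
Qed.

(* Up to positive factors, [hop k] is sin phi cot (pi (k+1) / N) + cos phi, and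
   cot decreases. *)
Lemma hop_sign_change (phi : R) N : exists e m,
  [/\ e ^+ 2 = 1, forall k, (k < m)%N -> 0 <= e * hop N.+2 phi k
    & forall k, (m <= k < N.+1)%N -> e * hop N.+2 phi k <= 0].
Proof.
have [e e1 e_phi] : exists2 e : R, e ^+ 2 = 1 & 0 <= e * sin phi.
  case: (lerP 0 (sin phi)) => s0; first by exists 1; rewrite ?expr1n// mul1r.
  by exists (-1); rewrite ?sqrrN ?expr1n// mulN1r oppr_ge0 ltW.
pose s k : R := pi * k.+1%:R / N.+2%:R.
have s_lt j k : (j < k)%N -> s j < s k.
  by move=> lt_jk; rewrite /s ltr_pM2r ?invr_gt0// ltr_pM2l ?pi_gt0// ltr_nat ltnS.
have s_gt0 k : 0 < s k by rewrite /s divr_gt0// mulr_gt0 ?pi_gt0.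
have s_ltpi k : (k < N.+1)%N -> s k < pi.
  by move=> /s_lt /lt_le_trans; apply; rewrite /s mulfK ?pnatr_eq0.
have sin_s k : (k < N.+1)%N -> 0 < sin (s k).
  by move=> lt_k; apply: sin_gt0_pi; rewrite s_gt0 s_ltpi.
have hop_le0 k : (k < N.+1)%N -> (e * hop N.+2 phi k <= 0) = (e * sin (phi + s k) <= 0).
  by move=> lt_k; rewrite /hop mulrA pmulr_lle0// sin_s.
have hop_mono j k : (j <= k < N.+1)%N -> e * hop N.+2 phi j <= 0 -> e * hop N.+2 phi k <= 0.
  rewrite leq_eqVlt => /andP[/orP[/eqP->//|lt_jk] lt_k].
  have lt_j := ltn_trans lt_jk lt_k; rewrite !hop_le0// => j_le0.
  rewrite -(pmulr_lle0 _ (sin_s _ lt_j)).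
  (* The monotonicity of the cotangent, cleared of denominators. *)
  have -> : e * sin (phi + s k) * sin (s j) =
      e * sin (phi + s j) * sin (s k) - e * sin phi * sin (s k - s j).
    by rewrite !sinD cosN sinN; ring.
  rewrite subr_le0; apply: le_trans (_ : 0 <= _).
    by rewrite pmulr_lle0// sin_s.
  rewrite mulr_ge0// ltW// sin_gt0_pi// subr_gt0 s_lt//=.
  by rewrite ltrBlDr (lt_trans (s_ltpi _ lt_k))// ltrDl.
pose a k := e * hop N.+2 phi k <= 0.
(* The first index with nonpositive sign; [find] returns [N.+1] if there is none, and the second
   range is then empty. *)
exists e, (find a (iota 0 N.+1)); split => // k.
  move=> lt_k; have := before_find 0%N lt_k; rewrite nth_iota ?add0n.
    by rewrite /a => /negbT; rewrite -ltNge => /ltW.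
  by apply: leq_trans lt_k _; rewrite -[X in (_ <= X)%N](size_iota 0) find_size.
move=> /andP[le_mk lt_k].
have lt_m : (find a (iota 0 N.+1) < N.+1)%N := leq_ltn_trans le_mk lt_k.
have has_a : has a (iota 0 N.+1) by rewrite has_find size_iota.
have := nth_find 0%N has_a; rewrite nth_iota// add0n; apply: hop_mono.
by rewrite le_mk.
Qed.

End RealRoots.

(** * Location of the zeros and bounds on their modulus *)

Section Spectrum.
Variable R : realType.
Implicit Types (phi theta kappa : R) (z : R[i]).
Local Arguments conjc : simpl never.

Lemma horner_continuant (K : comNzRingType) (e : nat -> K) n x :
  (continuant 'X (fun k => (e k)%:P) n).[x] = continuant x e n.
Proof.
elim/ltn_ind: n => -[|[|n]] IH; first by rewrite hornerC.
  by rewrite /= !subr0 !mulr1 hornerX.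
by rewrite !continuantSS hornerD hornerN !hornerM hornerX hornerC !IH.
Qed.

Lemma half_continuant_Qpoly N phi z :
  (Qpoly N.+2 phi).[z] = expi ((N.+2 %/ 2)%:R * phi) * z ^+ (N.+2 %% 2)
    * (map_poly (real_complex R) (half_continuant (hop N.+2 phi) N.+2)).[expi (- phi) * z ^+ 2].
Proof.
rewrite Qpoly_chambers chambers_continuant horner_continuant continuantE ?expi_neq0//.
by rewrite divn2 modn2 expiMn expiN.
Qed.

(** After rotation by e^{-i phi / 2} the square is real, so the real or the imaginary part
    vanishes. *)
Lemma cross_real_square phi z (x : R) : expi (- phi) * z ^+ 2 = x%:C -> cross (phi / 2) z.
Proof.
move=> zx; have [y zE] : exists y, z = expi (phi / 2) * y.
  by exists (expi (- (phi / 2)) * z); rewrite mulrA -expiD subrr expi0 mul1r.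
have : y ^+ 2 = x%:C.
  rewrite -zx zE exprMn [expi (phi / 2) ^+ 2]expr2 mulrA -!expiD.
  by rewrite (_ : - phi + _ = 0) ?expi0 ?mul1r//; field.
rewrite zE; case: y {zE} => y1 y2; rewrite expr2 => /(congr1 (@complex.Im R)) /=.
rewrite mulrC -mulr2n => /eqP; rewrite mulrn_eq0 mulf_eq0 /= => /orP[] /eqP ->.
  by left; exists y1.
right; exists y2; rewrite expiD expi_pihalf -mulrA; congr (_ * _).
by simpc.
Qed.

Lemma Qpoly_root_cross N phi z : (Qpoly N.+2 phi).[z] = 0 -> cross (phi / 2) z.
Proof.
have [e [m [e1 left_sign right_sign]]] := hop_sign_change phi N.
have rooted := half_continuant_real_rooted e1 left_sign right_sign.
rewrite half_continuant_Qpoly => /eqP; rewrite !mulf_eq0 (negPf (expi_neq0 _)) /=.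
case/orP => [|/rooted[x]]; last exact: cross_real_square.
rewrite expf_eq0 => /andP[_ /eqP ->]; apply: (@cross_real_square _ _ 0).
by rewrite expr0n mulr0.
Qed.

Lemma mulc_conj (x : R[i]) : x * x^*%C = (complex.Re x ^+ 2 + complex.Im x ^+ 2)%:C.
Proof. by case: x => a b; rewrite /conjc /=; simpc; rewrite !expr2; congr (_ +i* _); ring. Qed.

(** Summed over the bonds of the ring, this bounds the quadratic form of the hopping term by the
    squared norm. *)
Lemma Re_mul_conj_le (u x y : R[i]) : u * u^*%C = 1 ->
  `|complex.Re (x * u * y^*%C)| <=
    (complex.Re x ^+ 2 + complex.Im x ^+ 2 + (complex.Re y ^+ 2 + complex.Im y ^+ 2)) / 2.
Proof.
move=> u1.
have -> : complex.Re x ^+ 2 + complex.Im x ^+ 2 =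
    complex.Re (x * u) ^+ 2 + complex.Im (x * u) ^+ 2.
  apply: complexI; rewrite -!mulc_conj rmorphM /=.
  by rewrite mulrACA u1 mulr1.
case: (x * u) y => [a b] [c d]; rewrite /conjc /= ler_norml; apply/andP; split.
  have := addr_ge0 (sqr_ge0 (a + c)) (sqr_ge0 (b + d)); nra.
have := addr_ge0 (sqr_ge0 (a - c)) (sqr_ge0 (b - d)); nra.
Qed.

(* The eigenvalue is the Rayleigh quotient of [A = e^{i phi} X + D] at an
   eigenvector, where [X] and [D] are self-adjoint contractions. *)
Lemma eigenvalue_opA N phi theta kappa z : eigenvalue (opA N (expi kappa) phi theta) z ->
  exists a b : R, [/\ `|a| <= 1, `|b| <= 1 & z = expi phi * a%:C + b%:C].
Proof.
case/eigenvalueP => v vA v0.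
pose q (x : R[i]) := complex.Re x ^+ 2 + complex.Im x ^+ 2.
have q_ge0 x : 0 <= q x by rewrite addr_ge0 ?sqr_ge0.
pose n := \sum_j q (v 0 j).
have n_gt0 : 0 < n.
  rewrite lt_neqAle sumr_ge0// andbT eq_sym; apply: contraNneq v0 => /eqP.
  rewrite psumr_eq0// => /allP q0; apply/eqP/rowP => j; rewrite mxE.
  have := q0 j (mem_index_enum _); rewrite /= /q paddr_eq0 ?sqr_ge0// !sqrf_eq0.
  by case: (v 0 j) => x y /= /andP[/eqP -> /eqP ->].
(* Contribution of bond [j] to the quadratic form of the shift; the inverse shift contributes the
   conjugate, so their average is the real part. Here [v] is a left eigenvector. *)
pose t j := v 0 (ordS j) * twist N (expi kappa) j * (v 0 j)^*%C.
pose a := \sum_j complex.Re (t j).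
pose D (j : 'I_N) := cos (2 * pi * j%:R / N%:R + theta).
pose b := \sum_j D j * q (v 0 j).
have twist1 j : twist N (expi kappa) j * (twist N (expi kappa) j)^*%C = 1.
  by rewrite /twist; case: eqP => _; rewrite ?conjc_expi ?divff ?expi_neq0// rmorph1 mulr1.
have twistV j : twist N (expi kappa)^-1 j = (twist N (expi kappa) j)^*%C.
  by rewrite /twist; case: eqP => _; rewrite ?conjc_expi ?rmorph1.
have a_le : `|a| <= n.
  apply: le_trans (ler_norm_sum _ _ _) _.
  apply: (@le_trans _ _ (\sum_j (q (v 0 (ordS j)) + q (v 0 j)) / 2)).
    by apply: ler_sum => j _; exact: Re_mul_conj_le.
  rewrite -mulr_suml big_split /= -/n.
  have <- : n = \sum_j q (v 0 (ordS j)) by rewrite /n (reindex_inj (@ordS_inj N)).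
  lra.
have b_le : `|b| <= n.
  apply: le_trans (ler_norm_sum _ _ _) _; apply: ler_sum => j _.
  by rewrite normrM (ger0_norm (q_ge0 _)) ler_piMl// cos_max.
have zn : z * n%:C = expi phi * a%:C + b%:C.
  have row j : z * v 0 j = v 0 j * (D j)%:C
      + v 0 (ord_pred j) * (expi phi / 2 * twist N (expi kappa)^-1 (ord_pred j))
      + v 0 (ordS j) * (expi phi / 2 * twist N (expi kappa) j).
    have <- : (v *m opA N (expi kappa) phi theta) 0 j = z * v 0 j by rewrite vA mxE.
    by rewrite opAE ?expi_neq0// mul_mx_cyclic.
  have up : \sum_j v 0 (ord_pred j) * twist N (expi kappa)^-1 (ord_pred j) * (v 0 j)^*%C
      = \sum_j (t j)^*%C.
    rewrite (reindex_inj (@ordS_inj N)); apply: eq_bigr => j _.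
    by rewrite ordSK twistV /t !rmorphM /= conjcK; ring.
  rewrite /n rmorph_sum mulr_sumr /=.
  transitivity (expi phi / 2 *
    (\sum_j v 0 (ord_pred j) * twist N (expi kappa)^-1 (ord_pred j) * (v 0 j)^*%C
     + \sum_j t j) + \sum_j (D j * q (v 0 j))%:C).
    rewrite -big_split /= mulr_sumr -big_split /=; apply: eq_bigr => j _.
    by rewrite rmorphM /= /q -mulc_conj mulrA row /t; ring.
  rewrite up -big_split /= /a /b !rmorph_sum /= -mulrA; congr (_ * _ + _).
  rewrite mulr_sumr; apply: eq_bigr => j _.
  by rewrite addrC addcJ mulrA mulVf ?mul1r// pnatr_eq0.
exists (a / n), (b / n); rewrite !normrM normfV (gtr0_norm n_gt0).
rewrite !ler_pdivrMr// !mul1r; split => //.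
have nC : n%:C != 0 by rewrite fmorph_eq0 gt_eqF.
by apply: (mulIf nC); rewrite zn mulrDl -mulrA -!rmorphM /= !divfK// gt_eqF.
Qed.

Lemma norm_expiM phi (t : R) : `|expi phi * t%:C| = `|t|%:C.
Proof.
rewrite normrM !normc_def /= cos2Dsin2 sqrtr1 mul1r.
by rewrite expr0n addr0 sqrtr_sqr.
Qed.

(** Rotated by e^{-i phi / 2}, the value e^{i phi} a + b becomes (a + b) cos (phi / 2) + i (a - b)
    sin (phi / 2), with |a| and |b| at most 1. Each line of the cross retains one of the two
    parts. *)
Lemma eigenvalue_opA_bound N phi theta kappa z :
  eigenvalue (opA N (expi kappa) phi theta) z ->
  (line (phi / 2) z -> `|z| <= (2 * `|cos (phi / 2)|)%:C)
  /\ (line (phi / 2 + pi / 2) z -> `|z| <= (2 * `|sin (phi / 2)|)%:C).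
Proof.
move=> /eigenvalue_opA[a [b [a1 b1 zE]]].
have rot : expi (- (phi / 2)) * z = expi (phi / 2) * a%:C + expi (- (phi / 2)) * b%:C.
  by rewrite zE mulrDr mulrA -expiD; congr (expi _ * _ + _); field.
have le2 x y : `|x| <= 1 -> `|y| <= 1 -> `|x + y| <= 2 :> R.
  by move=> x1 y1; rewrite (le_trans (ler_normD _ _))// -[2]/(1 + 1) lerD.
split=> -[t zt]; rewrite [in leLHS]zt norm_expiM lecR; move: rot.
  rewrite zt mulrA -expiD addNr expi0 mul1r => /(congr1 (@complex.Re R)).
  rewrite /expi cosN sinN /= => E.
  have -> : t = (a + b) * cos (phi / 2) by rewrite E; ring.
  by rewrite normrM ler_wpM2r// le2.
rewrite zt mulrA -expiD addKr expi_pihalf => /(congr1 (@complex.Im R)).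
rewrite /expi cosN sinN /= => E.
have -> : t = (a - b) * sin (phi / 2).
  (* This is the imaginary part of ['i * t%:C] as it unfolds in [E]. *)
  transitivity (0 * 0 + 1 * t); first by ring.
  by rewrite E; ring.
by rewrite normrM ler_wpM2r// le2// normrN.
Qed.

Lemma balanced_chi N phi theta tau : balanced N.+2 phi theta tau ->
  chi N.+2 tau phi theta = Qpoly N.+2 phi.
Proof.
case=> kappa [-> bal]; rewrite Qpoly_chambers.
rewrite chambers_continuant -(chambers_continuant N phi theta kappa) /chambers.
by rewrite bal mulr0 addr0.
Qed.

Lemma balanced_i N phi : (0 < N)%N -> balanced N phi (pi / (2 * N%:R)) 'i%C.
Proof.
move=> N0; exists (pi / 2); rewrite expi_pihalf; split => //.
have -> : N%:R * (pi / (2 * N%:R)) = pi / 2 :> R.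
  by field; rewrite pnatr_eq0 -lt0n.
by rewrite cos_pihalf rmorph0 mulr0 addr0.
Qed.

End Spectrum.

Theorem theorem1p3 (R : realType) (N : nat) (phi : R) (hN : (3 <= N)%N) :
  (exists P : {poly R},
     [/\ P \is monic, real_rooted P, size P = (N %/ 2).+1
       & forall z : R[i],
           (Qpoly N phi).[z] =
           expi ((N %/ 2)%:R * phi) * z ^+ (N %% 2)
           * (map_poly (real_complex R) P).[expi (- phi) * z ^+ 2]])
  /\ (forall z : R[i], (Qpoly N phi).[z] = 0 -> cross (phi / 2) z)
  /\ (forall (theta : R) (tau : R[i]),
        balanced N phi theta tau ->
        chi N tau phi theta = Qpoly N phi
        /\ spec (opA N tau phi theta) `<=` cross (phi / 2))
  /\ (exists (theta : R) (tau : R[i]), balanced N phi theta tau)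
  /\ balanced N phi (pi / (2 * N%:R)) 'i%C
  /\ (forall z : R[i], (Qpoly N phi).[z] = 0 ->
        (line (phi / 2) z -> `|z| <= (2 * `|cos (phi / 2)|)%:C)
        /\ (line (phi / 2 + pi / 2) z -> `|z| <= (2 * `|sin (phi / 2)|)%:C)).
Proof.
case: N hN => [|[|N]] // _.
have bal_i : balanced N.+2 phi (pi / (2 * N.+2%:R)) 'i%C by exact: balanced_i.
split; last split; last split; last split; last split => //.
- exists (half_continuant (hop N.+2 phi) N.+2).
  have [monicP sizeP] := half_continuant_monic (hop N.+2 phi) N.+2.
  have [e [m [e1 left_sign right_sign]]] := hop_sign_change phi N.
  split => //; last exact: half_continuant_Qpoly.
    exact: half_continuant_real_rooted e1 left_sign right_sign.
  by rewrite sizeP divn2.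
- exact: Qpoly_root_cross.
- move=> theta tau bal; have chiQ := balanced_chi bal; split => // z.
  by rewrite /spec /= eigenvalue_root_char -/(chi N.+2 tau phi theta) chiQ => /rootP /Qpoly_root_cross.
- by exists (pi / (2 * N.+2%:R)), 'i%C.
(* A zero of [Qpoly] is an eigenvalue of the operator for the explicit balanced pair, where
   [kappa = pi / 2] gives the twist ['i]; the numerical range bound then applies. *)
- move=> z Qz; have chiQ := balanced_chi bal_i.
  apply: (@eigenvalue_opA_bound R N.+2 phi (pi / (2 * N.+2%:R)) (pi / 2)).
  rewrite expi_pihalf eigenvalue_root_char.
  by rewrite -/(chi N.+2 'i%C phi (pi / (2 * N.+2%:R))) chiQ; apply/rootP.
Qed.
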